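(* Let $X$ be a positive definite metric space with at least two points. Then for any $x\in X$ we have $$|X\setminus\{x\}| = |X|\left(1+\frac{2w_x^2}{\bar c_x\,|X|}\right)^{-1}\quad\text{and}\quad \frac{w_i'}{|X\setminus\{x\}|}=\frac{w_i}{|X|}+\frac{c_{ix}}{\bar c_x}\,\frac{w_x}{|X|}$$ for any $i\in X$ with $i\neq x$, where $\mathbf{w}$ is the weighting on $X$ and $\mathbf{w}'$ is the weighting on $X\setminus\{x\}$.
   Context: Metric spaces $(X,d)$ are finite and nonempty; subspaces carry the restricted metric. The similarity matrix $Z\in\mathbb{R}^{X\times X}$ has entries $z_{ij}=e^{-d(i,j)}$; $X$ is positive definite if $Z$ is. Then the weighting is $\mathbf{w}=Z^{-1}\mathbf{1}$ and the magnitude is $|X|=\mathbf{1}^T\mathbf{w}$ ($\mathbf{1}$ the all-ones vector); nonempty subspaces of positive definite spaces are positive definite. $K=\tfrac12\big(I-\tfrac{\mathbf{1}\mathbf{1}^T}{n}\big)Z\big(I-\tfrac{\mathbf{1}\mathbf{1}^T}{n}\big)$ with $n=\#X$, and $K^\dagger$ is its Moore--Penrose pseudoinverse. Set $c_{ij}:=-(K^\dagger)_{ij}$ for $i\neq j$, and $\bar c_i:=(K^\dagger)_{ii}=\sum_{j\neq i}c_{ij}$. *)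

(* Defs.v *)
From HB Require Import structures.
From mathcomp Require Import all_boot all_order all_algebra.
From mathcomp Require Import all_classical all_reals all_analysis.

Set Implicit Arguments.
Unset Strict Implicit.
Unset Printing Implicit Defensive.

Import Order.TTheory GRing.Theory Num.Theory.

Local Open Scope ring_scope.

#[short(type="finMetricType")]
HB.structure Definition FinMetric (R : numDomainType) :=
  { M of Finite M & Metric R M }.

(* [submetric A] is the set A as a metric space, with the restricted metric. *)
Section Submetric.
Context {R : realType} {X : finMetricType R}.

Definition submetric (A : {set X}) : Type := {y : X | y \in A}.

Variable A : {set X}.

HB.instance Definition _ := SubFinite.on (submetric A).

Let dist (u v : submetric A) : R := mdist (val u) (val v).

Let distxx u : dist u u = 0. Proof. exact: mdistxx. Qed.

Let dist_positivity u v : dist u v = 0 -> u = v.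
Proof. by move=> /mdist_positivity /val_inj. Qed.

Let dist_sym u v : dist u v = dist v u. Proof. exact: metric_sym. Qed.

Let dist_triangle v u w : dist u w <= dist u v + dist v w.
Proof. exact: metric_triangle. Qed.

HB.instance Definition _ := isMetric.Build R (submetric A)
  distxx dist_positivity dist_sym dist_triangle.

Lemma mdist_submetric (u v : submetric A) : mdist u v = mdist (val u) (val v).
Proof. by []. Qed.

End Submetric.

Definition posdef_mx (R : realType) (n : nat) (M : 'M[R]_n) : Prop :=
  M^T = M /\ forall v : 'cV[R]_n, v != 0 -> 0 < (v^T *m M *m v) 0 0.

(* The four Penrose equations. The library's [pinvmx] only satisfies the first
   one in general, so it is not the Moore-Penrose pseudoinverse. *)
Definition penrose (R : realType) (m n : nat)
    (A : 'M[R]_(m, n)) (B : 'M[R]_(n, m)) : Prop :=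
  [/\ A *m B *m A = A, B *m A *m B = B,
      (A *m B)^T = A *m B & (B *m A)^T = B *m A].

Section MoorePenrose.
Variable R : realType.

Lemma gram_unit (r n : nat) (C : 'M[R]_(r, n)) :
  row_free C -> C *m C^T \in unitmx.
Proof.
move=> fC; rewrite -row_free_unit -kermx_eq0.
apply/eqP/row_matrixP => i; rewrite row0.
set u := row i _.
have uG : u *m (C *m C^T) = 0 by rewrite -row_mul mulmx_ker row0.
have uC0 : u *m C = 0.
  have : (u *m C) *m (u *m C)^T = 0 by rewrite trmx_mul !mulmxA -mulmxA -mulmxA
    (mulmxA C) mulmxA uG mul0mx.
  move/matrixP/(_ 0 0); rewrite !mxE => /eqP.
  rewrite psumr_eq0 => [/allP h|j _]; last by rewrite !mxE -expr2 sqr_ge0.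
  apply/matrixP => a j; rewrite (ord1 a) [RHS]mxE.
  have := h j (mem_index_enum j); rewrite [_^T _ _]mxE -expr2 sqrf_eq0.
  by move/eqP.
by apply: (row_free_inj fC); rewrite uC0 mul0mx.
Qed.

Lemma penrose_factor (m n r : nat) (C : 'M[R]_(m, r)) (D : 'M[R]_(r, n)) :
    C^T *m C \in unitmx -> D *m D^T \in unitmx ->
  penrose (C *m D) (D^T *m invmx (D *m D^T) *m (invmx (C^T *m C) *m C^T)).
Proof.
move=> uC uD; set P := invmx (D *m D^T); set Q := invmx (C^T *m C).
have DP : D *m (D^T *m P) = 1%:M by rewrite mulmxA mulmxV.
have QC : Q *m C^T *m C = 1%:M by rewrite -mulmxA mulVmx.
have PT : P^T = P by rewrite trmx_inv trmx_mul trmxK.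
have QT : Q^T = Q by rewrite trmx_inv trmx_mul trmxK.
have AB : C *m D *m (D^T *m P *m (Q *m C^T)) = C *m (Q *m C^T).
  by rewrite -mulmxA (mulmxA D) DP mul1mx.
have BA : D^T *m P *m (Q *m C^T) *m (C *m D) = D^T *m P *m D.
  by rewrite -mulmxA (mulmxA (Q *m C^T)) QC mul1mx.
split.
- by rewrite AB -mulmxA (mulmxA (Q *m C^T)) QC mul1mx.
- by rewrite BA -mulmxA (mulmxA D) DP mul1mx.
- by rewrite AB !trmx_mul trmxK QT mulmxA.
- by rewrite BA !trmx_mul trmxK PT mulmxA.
Qed.

Lemma penrose_exists (m n : nat) (A : 'M[R]_(m, n)) : exists B, penrose A B.
Proof.
have uC : (col_base A)^T *m col_base A \in unitmx.
  rewrite -{2}[col_base A]trmxK; apply: gram_unit.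
  by rewrite /row_free mxrank_tr -/(row_full _) col_base_full.
have uD : row_base A *m (row_base A)^T \in unitmx.
  by apply: gram_unit; exact: row_base_free.
have := penrose_factor uC uD; set B := (X in penrose _ X); rewrite mulmx_base.
by exists B.
Qed.

Lemma penrose_unique (m n : nat) (A : 'M[R]_(m, n)) (B B' : 'M[R]_(n, m)) :
  penrose A B -> penrose A B' -> B = B'.
Proof.
move=> [ABA BAB sAB sBA] [AB'A B'AB' sAB' sB'A].
have E1 : A *m B = A *m B'.
  by rewrite -sAB -{1}AB'A -mulmxA trmx_mul sAB sAB' mulmxA ABA.
have E2 : B *m A = B' *m A.
  by rewrite -sBA -{1}AB'A -mulmxA mulmxA trmx_mul sB'A sBA -mulmxA
    (mulmxA A B A) ABA.
by rewrite -BAB -mulmxA E1 mulmxA E2 B'AB'.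
Qed.

Definition mpinv (m n : nat) (A : 'M[R]_(m, n)) : 'M[R]_(n, m) :=
  xget 0 [set B | penrose A B]%classic.

Lemma mpinvP (m n : nat) (A : 'M[R]_(m, n)) : penrose A (mpinv A).
Proof.
have [B AB] := penrose_exists A.
exact: (@xgetPex _ 0 [set B | penrose A B]%classic (ex_intro _ B AB)).
Qed.

End MoorePenrose.

(* Matrices in R^{X x X} are indexed through the enumeration of X; functions on
   points of X below are read off through [enum_rank]. *)
Section Magnitude.
Context {R : realType}.
Variable X : finMetricType R.

Definition simmx : 'M[R]_#|X| :=
  \matrix_(i, j) expR (- mdist (enum_val i) (enum_val j)).

Definition posdef_metric : Prop := posdef_mx simmx.

Definition ones : 'cV[R]_#|X| := const_mx 1.

(* The next two definitions are meant for positive definite X, where [simmx] is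
   invertible ([invmx] is the identity on singular matrices). *)
Definition weighting_vec : 'cV[R]_#|X| := invmx simmx *m ones.

Definition magnitude : R := (ones^T *m weighting_vec) 0 0.

Definition weighting (i : X) : R := weighting_vec (enum_rank i) 0.

Definition centering_mx : 'M[R]_#|X| :=
  1%:M - (#|X|%:R)^-1 *: (ones *m ones^T).

Definition Kmx : 'M[R]_#|X| :=
  2^-1 *: (centering_mx *m simmx *m centering_mx).

(* Only used for i != j. *)
Definition coef_c (i j : X) : R := - mpinv Kmx (enum_rank i) (enum_rank j).

Definition coef_cbar (i : X) : R := mpinv Kmx (enum_rank i) (enum_rank i).

End Magnitude.

(* Main.v *)
Require Import Defs.
From HB Require Import structures.
From mathcomp Require Import all_boot all_order all_algebra.
From mathcomp Require Import all_classical all_reals all_analysis.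
From mathcomp Require Import ring.

(** Let W be the inverse of the similarity matrix Z, w = W 1 the weighting and
    m = 1^T W 1 the magnitude of X. Both sides of each identity are rational
    functions of m and of the entries of W and w, for two reasons.

    On the right-hand sides, the pseudoinverse of K has a closed form:
    K^+ = 2 (W - w w^T / m) ([mpinv_Kmx]). Indeed L = W - w w^T / m is symmetric
    and kills 1, so it is unchanged by the centering projection P, and
    Z L = I - 1 w^T / m gives P Z P L = P Z L = P; the Penrose equations then
    hold with K (2 L) = (2 L) K = P, and they determine the pseudoinverse. So
    c_ix and cbar_x are, up to sign, entries of 2 L.

    On the left-hand sides, the similarity matrix of X minus x is Z with row and
    column x deleted, and its inverse is W - W e_x e_x^T W / W_xx with row and
    column x deleted ([invmx_punctured]). Summing rows gives
    w'_i = w_i - W_ix w_x / W_xx, and summing those gives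
    |X minus x| = m - w_x^2 / W_xx.

    The identities are then field identities whose denominators are m, W_xx and
    W_xx m - w_x^2. The first two are positive since W is positive definite; the
    third is m L_xx, and L_xx > 0 because L = L^T Z L and column x of L is
    nonzero as soon as X has two points ([laplacian_diag_gt0]). *)

Set Implicit Arguments.
Unset Strict Implicit.
Unset Printing Implicit Defensive.

Import Order.TTheory GRing.Theory Num.Theory.

Local Open Scope ring_scope.

(** * Positive definite matrices *)

Section PositiveDefinite.
Variables (R : realType) (n : nat) (M : 'M[R]_n).
Hypothesis Mpd : posdef_mx M.

Lemma posdef_unitmx : M \in unitmx.
Proof.
rewrite -row_free_unit -kermx_eq0; apply/eqP/row_matrixP => i; rewrite row0.
set u := row i _.
have uM : u *m M = 0 by rewrite -row_mul mulmx_ker row0.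
apply/eqP/negPn/negP => u0.
have := Mpd.2 u^T; rewrite trmxK uM mul0mx mxE ltxx => h.
by have /h : u^T != 0 by rewrite -trmx0 (inj_eq (@trmx_inj _ _ _)).
Qed.

Lemma posdef_invmx : posdef_mx (invmx M).
Proof.
have uM := posdef_unitmx; split; first by rewrite trmx_inv Mpd.1.
move=> v v0.
have Wv0 : invmx M *m v != 0.
  apply: contra v0 => /eqP Wv; apply/eqP.
  by rewrite -[v]mul1mx -(mulmxV uM) -mulmxA Wv mulmx0.
have := Mpd.2 _ Wv0.
by rewrite trmx_mul trmx_inv Mpd.1 -!mulmxA mulKVmx.
Qed.

Lemma posdef_diag_gt0 k : 0 < M k k.
Proof.
have /Mpd.2 : delta_mx k 0 != 0 :> 'cV[R]_n.
  by apply/eqP => /matrixP/(_ k 0)/eqP; rewrite !mxE !eqxx oner_eq0.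
by rewrite trmx_delta -rowE -colE !mxE.
Qed.

End PositiveDefinite.

(** * Inverting a matrix with one row and one column deleted *)

Section Eliminate.
Variables (F : fieldType) (n : nat) (W : 'M[F]_n) (k : 'I_n).

Definition eliminate : 'M[F]_n := W - (W k k)^-1 *: (col k W *m row k W).

Lemma eliminateE i j : eliminate i j = W i j - W i k / W k k * W k j.
Proof. by rewrite !mxE big_ord1 !mxE mulrCA mulrA. Qed.

Hypothesis Wkk : W k k != 0.

Lemma eliminate_row j : eliminate k j = 0.
Proof. by rewrite eliminateE divff // mul1r subrr. Qed.

Lemma eliminate_col i : eliminate i k = 0.
Proof. by rewrite eliminateE divfK // subrr. Qed.

End Eliminate.

Section PuncturedInverse.
(* An injection f onto the indices other than k describes the deletion of index
   k up to a renumbering: the points of a subspace come with an enumeration of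
   their own, which need not follow that of the whole space. *)
Variables (F : fieldType) (n m : nat) (f : 'I_m -> 'I_n) (k : 'I_n).
Hypotheses (f_inj : injective f) (codomE : codom f =i predC1 k).

Lemma sum_punctured (V : nmodType) (g : 'I_n -> V) :
  \sum_j g j = g k + \sum_i g (f i).
Proof.
rewrite (bigD1 k) //=; congr (_ + _).
have E : perm_eq (map f (index_enum 'I_m)) (seq.filter (predC1 k) (index_enum 'I_n)).
  apply: uniq_perm; first by rewrite map_inj_uniq ?index_enum_uniq.
    by rewrite filter_uniq ?index_enum_uniq.
  move=> j; rewrite mem_filter mem_index_enum andbT -[RHS]codomE.
  apply/mapP/codomP => [[i _ ->]|[i ->]]; exists i => //.
  exact: mem_index_enum.
by rewrite -big_filter -(perm_big _ E) big_map.
Qed.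

(** Row k of [eliminate W k] vanishes, so the sums in the product of the two
    punctured matrices lose no term: they are entries of
    M *m eliminate W k = 1 - e_k (row k W) / W k k, which agrees with the
    identity off row k. *)
Lemma invmx_punctured (M : 'M[F]_n) :
    M \in unitmx -> invmx M k k != 0 ->
  invmx (mxsub f f M) = mxsub f f (eliminate (invmx M) k).
Proof.
move=> uM; set W := invmx M => Wkk.
have MS : mxsub f f M *m mxsub f f (eliminate W k) = 1%:M.
  transitivity (mxsub f f (M *m eliminate W k)).
    move: (eliminate W k) (eliminate_row Wkk) => S Sk.
    apply/matrixP => i j; rewrite !mxE [RHS]sum_punctured Sk mulr0 add0r.
    by apply: eq_bigr => l _; rewrite !mxE.
  rewrite mulmxBr -scalemxAr mulmxA colE mulmxA mulmxV // mul1mx.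
  apply/matrixP => i j; rewrite !mxE big_ord1 !mxE.
  have /negPf-> : f i != k by rewrite -[_ != _]codomE codom_f.
  by rewrite mul0r mulr0 subr0 (inj_eq f_inj).
have [uM' _] := mulmx1_unit MS.
by rewrite -[RHS](mulKmx uM') MS mulmx1.
Qed.

(** As column k of [eliminate W k] vanishes, the row sums of the punctured matrix
    are those of [eliminate W k]. *)
Lemma eliminate_row_sum (W : 'M[F]_n) : W k k != 0 -> forall i,
  (mxsub f f (eliminate W k) *m const_mx 1 : 'cV[F]_m) i 0 =
  (W *m const_mx 1 : 'cV[F]_n) (f i) 0
    - W (f i) k / W k k * (W *m const_mx 1 : 'cV[F]_n) k 0.
Proof.
move=> Wkk i.
transitivity ((eliminate W k *m const_mx 1 : 'cV[F]_n) (f i) 0).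
  move: (eliminate W k) (eliminate_col Wkk) => S Sk.
  rewrite !mxE [RHS]sum_punctured Sk mul0r add0r.
  by apply: eq_bigr => l _; rewrite !mxE.
rewrite mulmxBl -scalemxAl -mulmxA -row_mul; set v := W *m _.
by rewrite !mxE big_ord1 !mxE mulrCA mulrA.
Qed.

End PuncturedInverse.

(** * The pseudoinverse of the centered similarity matrix *)

Section Magnitude.
Variables (R : realType) (X : finMetricType R).
Hypotheses (X_gt0 : (0 < #|X|)%N) (hpd : posdef_metric X).

Local Notation W := (invmx (simmx X)).
Local Notation w := (weighting_vec X).
Local Notation m := (magnitude X).

Lemma ones_neq0 : ones X != 0.
Proof.
by apply/eqP => /matrixP/(_ (Ordinal X_gt0) 0)/eqP; rewrite !mxE oner_eq0.
Qed.

Lemma magnitude_gt0 : 0 < m.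
Proof.
by have := (posdef_invmx hpd).2 _ ones_neq0; rewrite -mulmxA.
Qed.

Lemma weighting_vecT : w^T = (ones X)^T *m W.
Proof. by rewrite trmx_mul (posdef_invmx hpd).1. Qed.

Lemma weighting_vecT_ones : w^T *m ones X = m%:M.
Proof. by rewrite weighting_vecT -mulmxA [LHS]mx11_scalar. Qed.

Lemma magnitude_sum : m = \sum_i w i 0.
Proof. by rewrite [LHS]mxE; apply: eq_bigr => i _; rewrite !mxE mul1r. Qed.

Lemma weighting_vec_colsum k : w k 0 = \sum_j W j k.
Proof.
have -> : w k 0 = w^T 0 k by rewrite [RHS]mxE.
rewrite weighting_vecT mxE.
by apply: eq_bigr => j _; rewrite !mxE mul1r.
Qed.

Lemma centering_ones : centering_mx X *m ones X = 0.
Proof.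
rewrite mulmxBl mul1mx -scalemxAl -mulmxA.
have -> : (ones X)^T *m ones X = #|X|%:R%:M.
  apply/matrixP => i j; rewrite !ord1 !mxE.
  under eq_bigr => l _ do rewrite !mxE mulr1.
  by rewrite sumr_const card_ord.
by rewrite mul_mx_scalar scalerA mulVf ?pnatr_eq0 -?lt0n // scale1r subrr.
Qed.

Lemma centeringT : (centering_mx X)^T = centering_mx X.
Proof. by rewrite linearB linearZ /= trmx1 trmx_mul trmxK. Qed.

(** Half the pseudoinverse of [Kmx X]: a symmetric matrix with zero row sums and
    off-diagonal entries -c_ij / 2, that is, the Laplacian of the graph on X with
    edge weights c_ij / 2. *)
Definition laplacian := W - m^-1 *: (w *m w^T).

Lemma laplacianT : laplacian^T = laplacian.
Proof.
by rewrite linearB linearZ /= trmx_mul trmxK (posdef_invmx hpd).1.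
Qed.

Lemma laplacian_ones : laplacian *m ones X = 0.
Proof.
rewrite mulmxBl -scalemxAl -mulmxA weighting_vecT_ones mul_mx_scalar scalerA.
by rewrite mulVf ?gt_eqF ?magnitude_gt0 // scale1r subrr.
Qed.

Lemma centering_laplacian : centering_mx X *m laplacian = laplacian.
Proof.
apply: trmx_inj; rewrite trmx_mul centeringT laplacianT.
by rewrite mulmxBr mulmx1 -scalemxAr mulmxA laplacian_ones mul0mx scaler0 subr0.
Qed.

Lemma simmx_laplacian :
  simmx X *m laplacian = 1%:M - m^-1 *: (ones X *m w^T).
Proof.
by rewrite mulmxBr mulmxV ?posdef_unitmx// -scalemxAr mulmxA
  mulKVmx ?posdef_unitmx.
Qed.

Lemma Kmx_laplacian : Kmx X *m (2 *: laplacian) = centering_mx X.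
Proof.
rewrite -scalemxAl -scalemxAr scalerA mulVf ?pnatr_eq0 // scale1r.
rewrite -!mulmxA centering_laplacian simmx_laplacian mulmxBr mulmx1.
by rewrite -scalemxAr mulmxA centering_ones mul0mx scaler0 subr0.
Qed.

Lemma KmxT : (Kmx X)^T = Kmx X.
Proof. by rewrite linearZ /= !trmx_mul centeringT hpd.1 mulmxA. Qed.

Lemma laplacian_Kmx : (2 *: laplacian) *m Kmx X = centering_mx X.
Proof.
apply: trmx_inj; rewrite trmx_mul KmxT linearZ /= laplacianT centeringT.
exact: Kmx_laplacian.
Qed.

Lemma centering_Kmx : centering_mx X *m Kmx X = Kmx X.
Proof.
rewrite -scalemxAr !mulmxA; congr (_ *: (_ *m _ *m _)).
rewrite {2}/centering_mx mulmxBr mulmx1 -scalemxAr mulmxA centering_ones.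
by rewrite mul0mx scaler0 subr0.
Qed.

(** Both products of [Kmx X] with twice the Laplacian are the centering
    projection, which is symmetric and fixes both factors. *)
Lemma mpinv_Kmx : mpinv (Kmx X) = 2 *: laplacian.
Proof.
apply: penrose_unique (mpinvP _) _; split.
- by rewrite Kmx_laplacian centering_Kmx.
- by rewrite laplacian_Kmx -scalemxAr centering_laplacian.
- by rewrite Kmx_laplacian centeringT.
- by rewrite laplacian_Kmx centeringT.
Qed.

Lemma laplacianE i j : laplacian i j = W i j - w i 0 * w j 0 / m.
Proof.
rewrite /laplacian; move: w W => u V.
by rewrite !mxE big_ord1 !mxE mulrC.
Qed.

(** With L the Laplacian, L = L^T Z L makes L k k the quadratic form of Z at
    column k of L. That column is nonzero: otherwise column k of
    Z L = 1 - ones w^T / m vanishes, where a row l != k forces w k = 0 and row k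
    then reads 1 = 0. On a one-point space L is 0. *)
Lemma laplacian_diag_gt0 k : (1 < #|X|)%N -> 0 < laplacian k k.
Proof.
move=> X_gt1.
have LZL : laplacian^T *m simmx X *m laplacian = laplacian.
  rewrite -mulmxA simmx_laplacian mulmxBr mulmx1 -scalemxAr mulmxA laplacianT.
  by rewrite laplacian_ones mul0mx scaler0 subr0.
have colL0 : col k laplacian != 0.
  have [l lk] : exists l : 'I_#|X|, l != k.
    have : (0 < #|predC1 k|)%N by rewrite cardC1 card_ord -ltnS prednK.
    by case/card_gt0P => l lk; exists l.
  apply/eqP => colL0; have : col k (simmx X *m laplacian) = 0.
    by rewrite colE -mulmxA -colE colL0 mulmx0.
  rewrite simmx_laplacian => /matrixP E; have := E k 0; have := E l 0.
  rewrite !mxE !big_ord1 !mxE eqxx (negPf lk) mul1r sub0r => /eqP.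
  by rewrite oppr_eq0 => /eqP -> /eqP; rewrite subr0 oner_eq0.
have := hpd.2 _ colL0; rewrite !colE trmx_mul -!mulmxA trmx_delta.
rewrite (mulmxA (simmx X)) (mulmxA laplacian^T) (mulmxA laplacian^T) LZL.
by rewrite -colE -rowE !mxE.
Qed.

End Magnitude.

Theorem corollary4p18 (R : realType) (X : finMetricType R) (x : X)
    (hcard : (2 <= #|X|)%N) (hpd : posdef_metric X) :
  let X' := submetric [set~ x]%SET in
  magnitude X' =
    magnitude X * (1 + 2 * weighting x ^+ 2 / (coef_cbar x * magnitude X))^-1
  /\
  forall i : X',
    weighting i / magnitude X' =
      weighting (val i) / magnitude X
      + coef_c (val i) x / coef_cbar x * (weighting x / magnitude X).
Proof.
move=> X'.
have X_gt0 : (0 < #|X|)%N by apply: ltnW.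
set m := magnitude X; set k := enum_rank x.
set W := invmx (simmx X); set w := weighting_vec X.
have m0 : m != 0 by rewrite gt_eqF ?magnitude_gt0.
have Wkk : W k k != 0 by rewrite gt_eqF ?posdef_diag_gt0//; exact: posdef_invmx.
have L0 : W k k * m - w k 0 ^+ 2 != 0.
  have := laplacian_diag_gt0 X_gt0 hpd k hcard; rewrite laplacianE -/m -/W -/w.
  move=> /lt0r_neq0; apply: contra => /eqP E; apply/eqP.
  have -> : W k k = w k 0 ^+ 2 / m by rewrite -[LHS](mulfK m0) (subr0_eq E).
  by rewrite expr2 subrr.
pose f (i : 'I_#|{: X'}|) : 'I_#|X| := enum_rank (val (enum_val i)).
have f_inj : injective f.
  by move=> i j /enum_rank_inj /val_inj /enum_val_inj.
have codomE : codom f =i predC1 k.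
  move=> j; rewrite !inE; apply/codomP/idP => [[i ->]|jk].
    rewrite (inj_eq enum_rank_inj).
    by have := valP (enum_val i); rewrite !inE.
  have xj : enum_val j \in [set~ x]%SET.
    by rewrite !inE; apply: contra jk => /eqP jx; rewrite /k -jx enum_valK.
  exists (enum_rank (Sub (enum_val j) xj : X')).
  by rewrite /f enum_rankK SubK enum_valK.
have Z' : simmx X' = mxsub f f (simmx X).
  by apply/matrixP => i j; rewrite !mxE !enum_rankK.
have w' (i : 'I_#|{: X'}|) :
    weighting_vec X' i 0 = w (f i) 0 - W (f i) k / W k k * w k 0.
  rewrite /weighting_vec Z' (invmx_punctured f_inj codomE) ?posdef_unitmx //.
  exact: (eliminate_row_sum f_inj codomE).
have m' : magnitude X' = m - w k 0 ^+ 2 / W k k.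
  (* The sum over X minus x extends to X, since the summand vanishes at x; W is
     symmetric, so the sum of W j k over j is w k. *)
  pose g j := w j 0 - W j k / W k k * w k 0.
  have gk : g k = 0 by rewrite /g divff // mul1r subrr.
  rewrite magnitude_sum (eq_bigr (fun i => g (f i))) => [|i _]; last exact: w'.
  have -> : \sum_i g (f i) = \sum_j g j.
    by rewrite [RHS](sum_punctured f_inj codomE) gk add0r.
  rewrite sumrB -magnitude_sum.
  by rewrite -!mulr_suml -weighting_vec_colsum // expr2 mulrAC.
have cE i : mpinv (Kmx X) i k = 2 * (W i k - w i 0 * w k 0 / m).
  by rewrite mpinv_Kmx // mxE laplacianE.
rewrite /coef_cbar /coef_c /weighting -/k -/w.
split=> [|i]; rewrite m' ?w' !cE.
  field; rewrite -expr2 subrK mulf_neq0 //.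
  by rewrite m0 L0 Wkk.
rewrite /f enum_rankK.
by field; rewrite -expr2 m0 L0 Wkk.
Qed.
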